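(* Let $(M,H)$ be a Hamilton space with Hamiltonian vector field $\rho_H$ and adapted tangent structure $\mathcal{J}_H$. Let $\mathcal{N}$ be an arbitrary nonlinear connection on $T^{*}M\setminus\{0\}$ with projectors $h,v$, let $\nabla$ be the dynamical covariant derivative and $\Phi$ the Jacobi endomorphism induced by $\rho_H$ and $\mathcal{N}$. Then a vector field $X\in\mathcal{X}(T^{*}M\setminus\{0\})$ is an infinitesimal symmetry of $\rho_H$ if and only if $X$ is a Newtonoid vector field and satisfies $$\nabla(\mathcal{J}_H\nabla X)+\Phi(X)=0.$$
   Context: Hamilton space: $M$ is a smooth $n$-dimensional manifold and $H:T^{*}M\to\mathbb{R}$ is smooth on $T^{*}M\setminus\{0\}$ (zero section removed), continuous on the zero section, with $g^{ij}=\frac{\partial^2H}{\partial p_i\partial p_j}$ of rank $n$ and constant signature on $T^{*}M\setminus\{0\}$, in induced coordinates $(x^i,p_i)$; $(g_{ij})$ is the inverse matrix. All structures are considered on $T^{*}M\setminus\{0\}$. Adapted tangent structure: $\mathcal{J}_H=g_{ij}\,dx^i\otimes\frac{\partial}{\partial p_j}$, i.e. $\mathcal{J}_H(\partial/\partial x^i)=g_{ij}\,\partial/\partial p_j$, $\mathcal{J}_H(\partial/\partial p_i)=0$. Hamiltonian vector field: $\rho_H=\frac{\partial H}{\partial p_i}\frac{\partial}{\partial x^i}-\frac{\partial H}{\partial x^i}\frac{\partial}{\partial p_i}$, the vector field with $i_{\rho_H}\omega=-dH$, where $\omega=dp_i\wedge dx^i$. Nonlinear connection: a $(1,1)$-tensor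 field $\mathcal{N}$ with $\mathcal{N}^2=\mathrm{Id}$ and $\ker(\mathrm{Id}+\mathcal{N})$ equal to the vertical distribution spanned by $\partial/\partial p_i$; $h=\frac12(\mathrm{Id}+\mathcal{N})$, $v=\frac12(\mathrm{Id}-\mathcal{N})$. Dynamical covariant derivative on vector fields: $\nabla X=h[\rho_H,hX]+v[\rho_H,vX]$. Jacobi endomorphism: $\Phi=v\circ\mathcal{L}_{\rho_H}h$, where $(\mathcal{L}_{\rho_H}h)(X)=[\rho_H,hX]-h[\rho_H,X]$. Infinitesimal symmetry of $\rho_H$: a vector field $X$ with $[\rho_H,X]=0$. Newtonoid vector field: a vector field $X$ with $\mathcal{J}_H[\rho_H,X]=0$. *)

(* Defs.v *)
From HB Require Import structures.
From mathcomp Require Import all_boot all_order all_algebra.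
From mathcomp Require Import all_classical all_reals all_analysis.
Import Order.TTheory GRing.Theory Num.Theory numFieldNormedType.Exports.

Set Implicit Arguments.
Unset Strict Implicit.
Unset Printing Implicit Defensive.

Local Open Scope classical_set_scope.
Local Open Scope ring_scope.

Section Smooth.
Variables (R : realType) (V W : normedModType R).

Fixpoint Ck_on (k : nat) (U : set V) (f : V -> W) : Prop :=
  match k with
  | 0%N => forall x, U x -> {for x, continuous f}
  | k'.+1 => (forall x, U x -> differentiable f x) /\
             (forall v, Ck_on k' U (fun x => 'D_v f x))
  end.

Definition smooth_on (U : set V) (f : V -> W) : Prop := forall k, Ck_on k U f.

End Smooth.

(* A system of m-dimensional charts on a set T.  No axiom is imposed here: see
   [smooth_atlas] below.  [chart_coord a] is meaningful on [chart_dom a] only. *)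
Record charts (R : realType) (m : nat) (T : Type) := Charts {
  chart_index : Type ;
  chart_dom : chart_index -> set T ;
  chart_coord : chart_index -> T -> 'rV[R]_m }.

Section Charts.
Variables (R : realType) (m : nat) (T : Type) (A : charts R m T).
Implicit Types (a b : chart_index A) (t : T).

Definition chart_image a : set 'rV[R]_m := chart_coord a @` chart_dom a.

(* The coordinate expression F o (chart_coord a)^-1 of F, extended by 0 outside
   of the image of the chart. *)
Definition in_chart (W : zmodType) a (F : T -> W) (z : 'rV[R]_m) : W :=
  if pselect (exists t, chart_dom a t /\ chart_coord a t = z) is left e
  then F (projT1 (cid e)) else 0.

(* Entry (i, j) is the partial derivative of the j-th coordinate of chart b
   with respect to the i-th coordinate of chart a. *)
Definition coord_jacobian a b t : 'M[R]_m :=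
  jacobian (in_chart a (chart_coord b)) (chart_coord a t).

(* Fields are given by their components in every chart: [X a t] lists the
   components of X at t in the chart a, and is meaningful when [chart_dom a t].
   Tangent vectors are row vectors, on which endomorphisms act from the right
   (entry (i, j) of N is the coefficient of dx^i (x) d/dx^j). *)
Definition components := chart_index A -> T -> 'rV[R]_m.
Definition endo_components := chart_index A -> T -> 'M[R]_m.

Definition vanishes (X : components) : Prop :=
  forall a t, chart_dom a t -> X a t = 0.

Definition vector_field (X : components) : Prop :=
  (forall a b t, chart_dom a t -> chart_dom b t ->
     X b t = X a t *m coord_jacobian a b t) /\
  (forall a, smooth_on (chart_image a) (in_chart a (X a))).

Definition endo_field (N : endo_components) : Prop :=
  (forall a b t, chart_dom a t -> chart_dom b t ->
     N a t *m coord_jacobian a b t = coord_jacobian a b t *m N b t) /\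
  (forall a, smooth_on (chart_image a) (in_chart a (N a))).

Definition add_field (X Y : components) : components :=
  fun a t => X a t + Y a t.
Definition sub_field (X Y : components) : components :=
  fun a t => X a t - Y a t.
Definition apply_endo (N : endo_components) (X : components) : components :=
  fun a t => X a t *m N a t.

Definition bracket (X Y : components) : components := fun a t =>
  'D_(X a t) (in_chart a (Y a)) (chart_coord a t)
  - 'D_(Y a t) (in_chart a (X a)) (chart_coord a t).

(* The value at X of the Lie derivative of N along rho. *)
Definition lie_endo (rho : components) (N : endo_components) (X : components) :
    components :=
  sub_field (bracket rho (apply_endo N X)) (apply_endo N (bracket rho X)).

End Charts.

Record smooth_atlas (R : realType) (n : nat) (M : topologicalType)
    (A : charts R n M) : Prop := SmoothAtlas {
  atlas_cover : forall x : M, exists a : chart_index A, chart_dom a x ;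
  atlas_open : forall a : chart_index A, open (chart_dom a) ;
  (* the next three conditions: chart_coord a is a homeomorphism from
     chart_dom a onto an open set *)
  atlas_inj : forall (a : chart_index A) (x y : M),
    chart_dom a x -> chart_dom a y ->
    chart_coord a x = chart_coord a y -> x = y ;
  atlas_continuous : forall (a : chart_index A) (x : M),
    chart_dom a x -> {for x, continuous (chart_coord a)} ;
  atlas_open_map : forall (a : chart_index A) (U : set M),
    open U -> U `<=` chart_dom a -> open (chart_coord a @` U) ;
  atlas_smooth : forall a b : chart_index A,
    smooth_on (chart_coord a @` (chart_dom a `&` chart_dom b))
      (in_chart a (chart_coord b)) }.

Record manifold (R : realType) (n : nat) := Manifold {
  manifold_space :> topologicalType ;
  atlas : charts R n manifold_space ;
  manifold_hausdorff : hausdorff_space manifold_space ;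
  manifold_second_countable : @second_countable manifold_space ;
  manifold_atlas : smooth_atlas atlas }.

Section Cotangent.
Variables (R : realType) (n : nat) (M : manifold R n).

(* A covector at the point foot u is given by its components (p_i) in all the
   charts around foot u, subject to p_i = (d x'^j / d x^i) p'_j.  The value 0 in
   the other charts is a normalization, making equality of covectors Leibniz
   equality. *)
Record cotangent := Cotangent {
  foot : M ;
  covec : chart_index (atlas M) -> 'rV[R]_n ;
  covec_change : forall a b, chart_dom a foot -> chart_dom b foot ->
    covec a = covec b *m (coord_jacobian a b foot)^T ;
  covec_outside : forall a, ~ chart_dom a foot -> covec a = 0 }.

Definition zero_covector (u : cotangent) : Prop := forall a, covec u a = 0.

(* T*M with its zero section removed *)
Definition slit := {u : cotangent | ~ zero_covector u}.

(* The induced coordinates (x^i, p_i). *)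
Definition cotangent_charts : charts R (n + n) cotangent :=
  @Charts R (n + n) cotangent (chart_index (atlas M))
    (fun a u => chart_dom a (foot u))
    (fun a u => row_mx (chart_coord a (foot u)) (covec u a)).

Definition slit_charts : charts R (n + n) slit :=
  @Charts R (n + n) slit (chart_index (atlas M))
    (fun a u => chart_dom a (foot (sval u)))
    (fun a u => row_mx (chart_coord a (foot (sval u))) (covec (sval u) a)).

End Cotangent.

Section Hamilton.
Variables (R : realType) (n : nat) (M : manifold R n) (H : cotangent M -> R).
Implicit Types (a : chart_index (slit_charts M)) (u : slit M) (i j : 'I_n).

Definition ham_in_chart a : 'rV[R]_(n + n) -> R :=
  in_chart (A := slit_charts M) a (fun u => H (sval u)).

(* partial derivatives with respect to x^i and to p_i *)
Definition d_x i (f : 'rV[R]_(n + n) -> R) : 'rV[R]_(n + n) -> R :=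
  fun z => 'D_(delta_mx 0 (lshift n i)) f z.
Definition d_p i (f : 'rV[R]_(n + n) -> R) : 'rV[R]_(n + n) -> R :=
  fun z => 'D_(delta_mx 0 (rshift n i)) f z.

(* the matrix (g^{ij}) *)
Definition ham_hessian a u : 'M[R]_n :=
  \matrix_(i, j) d_p i (d_p j (ham_in_chart a)) (chart_coord a u).

(* A is congruent to a diagonal matrix with r entries 1, s entries -1 and the
   other ones 0. *)
Definition has_signature (A : 'M[R]_n) (r s : nat) : Prop :=
  (r + s <= n)%N /\
  exists2 P : 'M[R]_n, P \in unitmx &
    P *m A *m P^T =
      diag_mx (\row_(i < n) (if (i < r)%N then 1
                             else if (i < r + s)%N then -1 else 0)).

Record hamiltonian : Prop := Hamiltonian {
  ham_smooth : forall a, smooth_on (chart_image a) (ham_in_chart a) ;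
  ham_continuous : forall (a : chart_index (cotangent_charts M)) (u : cotangent M),
    chart_dom a u -> zero_covector u ->
    {for chart_coord a u, continuous (in_chart a H)} ;
  ham_rank : forall a u, chart_dom a u -> \rank (ham_hessian a u) = n ;
  ham_signature : exists r s : nat,
    forall a u, chart_dom a u -> has_signature (ham_hessian a u) r s }.

(* g_{ij} dx^i (x) d/dp_j *)
Definition adapted_tangent : endo_components (slit_charts M) := fun a u =>
  block_mx 0 (invmx (ham_hessian a u)) 0 0.

Definition ham_field : components (slit_charts M) := fun a u =>
  row_mx (\row_i d_p i (ham_in_chart a) (chart_coord a u))
         (\row_i - d_x i (ham_in_chart a) (chart_coord a u)).

Definition infinitesimal_symmetry (X : components (slit_charts M)) : Prop :=
  vanishes (bracket ham_field X).

Definition newtonoid (X : components (slit_charts M)) : Prop :=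
  vanishes (apply_endo adapted_tangent (bracket ham_field X)).

End Hamilton.

Section Connection.
Variables (R : realType) (n : nat) (M : manifold R n).

Record nonlinear_connection (N : endo_components (slit_charts M)) : Prop :=
  NonlinearConnection {
    connection_tensor : endo_field N ;
    connection_sqr : forall a u, chart_dom a u -> N a u *m N a u = 1%:M ;
    (* ker (Id + N) is the vertical distribution, spanned by the d/dp_i *)
    connection_ker : forall a u, chart_dom a u -> forall w : 'rV[R]_(n + n),
      w *m (1%:M + N a u) = 0 <-> lsubmx w = 0 }.

Definition hproj (N : endo_components (slit_charts M)) : endo_components (slit_charts M) :=
  fun a u => 2^-1 *: (1%:M + N a u).
Definition vproj (N : endo_components (slit_charts M)) : endo_components (slit_charts M) :=
  fun a u => 2^-1 *: (1%:M - N a u).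

Definition dyn_cov_deriv (H : cotangent M -> R) (N : endo_components (slit_charts M))
    (X : components (slit_charts M)) : components (slit_charts M) :=
  add_field (apply_endo (hproj N) (bracket (ham_field H) (apply_endo (hproj N) X)))
       (apply_endo (vproj N) (bracket (ham_field H) (apply_endo (vproj N) X))).

Definition jacobi_endo (H : cotangent M -> R) (N : endo_components (slit_charts M))
    (X : components (slit_charts M)) : components (slit_charts M) :=
  apply_endo (vproj N) (lie_endo (ham_field H) (hproj N) X).

End Connection.

(* Sanity checks: the induced coordinates (x, p) take all the values in the
   product of the image of a chart of M with R^n, and they separate points.
   So [in_chart] is the expected coordinate expression on T*M \ 0. *)
Lemma chain_rule (R : realType) (U V W : normedModType R) (f : U -> V)
    (g : V -> W) (x v : U) : differentiable f x -> differentiable g (f x) ->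
  'D_v (g \o f) x = 'D_('D_v f x) g (f x).
Proof.
move=> df dg; have dgf := differentiable_comp df dg.
by rewrite !deriveE // diff_comp.
Qed.

Lemma mul_jacobian (R : realType) (n m : nat) (f : 'rV[R]_n -> 'rV[R]_m)
    (x v : 'rV[R]_n) : differentiable f x -> v *m jacobian f x = 'D_v f x.
Proof. by move=> df; rewrite deriveE // /jacobian mul_rV_lin1. Qed.

Lemma jacobian_comp (R : realType) (n m p : nat) (f : 'rV[R]_n -> 'rV[R]_m)
  (g : 'rV[R]_m -> 'rV[R]_p) (k : 'rV[R]_n -> 'rV[R]_p) (x : 'rV[R]_n) :
  differentiable f x -> differentiable g (f x) -> differentiable k x ->
  (\forall w \near x, k w = (g \o f) w) ->
  jacobian k x = jacobian f x *m jacobian g (f x).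
Proof.
move=> df dg dk E.
apply/row_matrixP => i; rewrite !rowE mulmxA.
rewrite (mul_jacobian _ dk).
rewrite (mul_jacobian _ df).
rewrite (mul_jacobian _ dg).
rewrite (near_eq_derive _ E).
exact: chain_rule.
Qed.

Lemma in_chartE (R : realType) (n : nat) (M : manifold R n) (a : chart_index (atlas M))
  (W : zmodType) (F : M -> W) (x : M) : chart_dom a x -> in_chart a F (chart_coord a x) = F x.
Proof.
move=> ax; rewrite /in_chart; case: pselect => [e|]; last by case; exists x.
case: (cid e) => y [ay yx] /=; congr F.
exact: (atlas_inj (manifold_atlas M) ay ax yx).
Qed.

Lemma jac_cocycle (R : realType) (n : nat) (M : manifold R n) (a b c : chart_index (atlas M)) (x : M) :
  chart_dom a x -> chart_dom b x -> chart_dom c x ->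
  coord_jacobian a c x = coord_jacobian a b x *m coord_jacobian b c x.
Proof.
move=> ax bx cx.
set z := chart_coord a x.
pose f : 'rV[R]_n -> 'rV[R]_n := in_chart a (chart_coord b).
pose g : 'rV[R]_n -> 'rV[R]_n := in_chart b (chart_coord c).
pose k : 'rV[R]_n -> 'rV[R]_n := in_chart a (chart_coord c).
have fz : f z = chart_coord b x by exact: in_chartE.
have df : differentiable f z.
  have [+ _] := atlas_smooth (manifold_atlas M) a b 1%N.
  by apply; exists x.
have dg : differentiable g (f z).
  have [+ _] := atlas_smooth (manifold_atlas M) b c 1%N.
  by rewrite fz; apply; exists x.
have E : \forall w \near z, k w = (g \o f) w.
  have op : open (chart_coord a @` (chart_dom a `&` chart_dom b)).
    apply: (atlas_open_map (manifold_atlas M)) => [|y []//].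
    by apply: openI; exact: (atlas_open (manifold_atlas M)).
  have zin : (chart_coord a @` (chart_dom a `&` chart_dom b)) z by exists x.
  have := open_nbhs_nbhs (conj op zin).
  apply: filterS => w [y [ay bY] <-] /=.
  by rewrite /k /f /g !in_chartE.
have dk : differentiable k z.
  have [+ _] := atlas_smooth (manifold_atlas M) a c 1%N.
  by apply; exists x.
rewrite /coord_jacobian -/z -/f -/g -/k -fz.
exact: jacobian_comp.
Qed.

Lemma jac_id (R : realType) (n : nat) (M : manifold R n) (a : chart_index (atlas M)) (x : M) :
  chart_dom a x -> coord_jacobian a a x = 1%:M.
Proof.
move=> ax; set z := chart_coord a x.
pose f : 'rV[R]_n -> 'rV[R]_n := in_chart a (chart_coord a).
have df : differentiable f z.
  have [+ _] := atlas_smooth (manifold_atlas M) a a 1%N.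
  by apply; exists x.
have E : \forall w \near z, f w = id w.
  have op : open (chart_coord a @` (chart_dom a)).
    by apply: (atlas_open_map (manifold_atlas M)) => //; exact: (atlas_open (manifold_atlas M)).
  have zin : (chart_coord a @` (chart_dom a)) z by exists x.
  have := open_nbhs_nbhs (conj op zin).
  by apply: filterS => w [y ay <-] /=; rewrite /f in_chartE.
rewrite /coord_jacobian -/z -/f; apply/row_matrixP => i.
rewrite !rowE mulmx1 (mul_jacobian _ df).
by rewrite (near_eq_derive _ E) derive_id.
Qed.

Lemma covector_ex (R : realType) (n : nat) (M : manifold R n) (a : chart_index (atlas M)) (x : M) (p : 'rV[R]_n) :
  chart_dom a x -> exists u : cotangent M, foot u = x /\ covec u a = p.
Proof.
move=> ax.
pose q b := if pselect (chart_dom b x) is left _ then p *m (coord_jacobian b a x)^T else 0.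
have qE b : chart_dom b x -> q b = p *m (coord_jacobian b a x)^T by move=> ?; rewrite /q; case: pselect.
have q0 b : ~ chart_dom b x -> q b = 0 by move=> ?; rewrite /q; case: pselect.
have qc b c : chart_dom b x -> chart_dom c x -> q b = q c *m (coord_jacobian b c x)^T.
  by move=> bx cx; rewrite (qE _ bx) (qE _ cx) -mulmxA -trmx_mul -(jac_cocycle bx cx ax).
exists (Cotangent qc q0); split => //=.
by rewrite (qE _ ax) (jac_id ax) trmx1 mulmx1.
Qed.

Lemma slit_inj (R : realType) (n : nat) (M : manifold R n) (a : chart_index (slit_charts M)) (u v : slit M) :
  chart_dom a u -> chart_dom a v -> chart_coord a u = chart_coord a v -> u = v.
Proof.
case: u => [[x p pc p0] hu]; case: v => [[y q qc q0] hv] /= ax ay /eq_row_mx [xy pq].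
have E : x = y := atlas_inj (manifold_atlas M) ax ay xy.
subst y.
have pq' : p = q.
  apply/funext => b; have [bx|bx] := pselect (chart_dom b x); last by rewrite p0 // q0.
  by rewrite (pc b a) // (qc b a) // pq.
subst q; have ? := Prop_irrelevance pc qc; have ? := Prop_irrelevance p0 q0; subst.
by congr exist; exact: Prop_irrelevance.
Qed.

(* Main.v *)
Require Import Defs.
From mathcomp Require Import all_boot all_order all_algebra.
From mathcomp Require Import all_classical all_reals all_analysis.
Import Order.TTheory GRing.Theory Num.Theory numFieldNormedType.Exports.

(** Write rho for the Hamiltonian vector field and J for the adapted tangent
    structure.  The whole proof rests on one identity: J [rho, V] = - V for
    every vertical field V ([lsubmx_bracket_vertical], read through
    [mul_adapted_tangent]).  It holds because the d/dx^j component of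
    [rho, V^i d/dp_i] is - V^i d^2H/dp_i dp_j = - V^i g^{ij}, which J lowers
    with g_{ij}.

    Suppose that X is Newtonoid, that is, [rho, X] is vertical.  Splitting
    X = hX + vX gives J [rho, hX] = - J [rho, vX] = vX, and since J h = J and
    J v = 0 this says J (nabla X) = vX ([adapted_tangent_dyn_cov_deriv]).  As h
    kills vX, the first term of the equation is nabla (vX) = v [rho, vX]; as
    v h = 0, the second one is Phi X = v [rho, hX].  Their sum is
    v [rho, X] = [rho, X], the bracket being vertical ([newtonoid_equation]).
    So for a Newtonoid field the left-hand side of the equation is exactly
    [rho, X], and a symmetry is trivially Newtonoid.

    All of this is checked inside one chart.  The analysis needed is
    the additivity of the bracket, hence the differentiability of the
    coordinate expressions of rho, hX and vX. *)

Set Implicit Arguments.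
Unset Strict Implicit.
Unset Printing Implicit Defensive.

Local Open Scope classical_set_scope.
Local Open Scope ring_scope.

(** * Differentiability of matrix-valued maps *)

Section MatrixCalculus.
Variables (R : realType) (V : normedModType R).

Lemma differentiable_entry m n (F : V -> 'M[R]_(m, n)) z i j :
  differentiable F z -> differentiable (fun y => F y i j) z.
Proof.
move=> dF.
exact: (differentiable_comp dF (differentiable_coord (F z) i j)).
Qed.

(** A matrix-valued map is the finite sum of its entries times the constant
    elementary matrices. *)
Lemma differentiable_mx m n (F : V -> 'M[R]_(m, n)) z :
  (forall i j, differentiable (fun y => F y i j) z) -> differentiable F z.
Proof.
move=> dF.
have -> : F = \sum_i \sum_j (fun y => F y i j *: delta_mx i j).
  apply/funext => y; rewrite [LHS]matrix_sum_delta fct_sumE.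
  by apply: eq_bigr => i _; rewrite fct_sumE.
apply: differentiable_sum => i; apply: differentiable_sum => j.
exact: differentiableZl.
Qed.

Lemma differentiable_mulmx m n p (F : V -> 'M[R]_(m, n))
    (G : V -> 'M[R]_(n, p)) z :
  differentiable F z -> differentiable G z ->
  differentiable (fun y => F y *m G y) z.
Proof.
move=> dF dG; apply: differentiable_mx => i j.
have -> : (fun y => (F y *m G y) i j) =
    \sum_k ((fun y => F y i k) * (fun y => G y k j)).
  by apply/funext => y; rewrite mxE fct_sumE.
apply: differentiable_sum => k.
by apply: differentiableM; exact: differentiable_entry.
Qed.

(** The first-order expansion of f at z is also one of g, and such an expansion
    determines the differential. *)
Lemma near_eq_differentiable (W : normedModType R) (f g : V -> W) z :
  {near z, f =1 g} -> differentiable f z -> differentiable g z.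
Proof.
move=> fg df.
have [cf Ef] := (diff_locallyP z f).1 df.
have Eg : g \o shift z = cst (g z) + 'd f z +o_ (0 : V) id.
  apply/eqaddoP => eps eps0; move/eqaddoP : Ef => /(_ eps eps0).
  have := fg; rewrite (near_shift 0) subr0 => fg0.
  apply: filterS2 fg0 => y /= fgy.
  rewrite !fctE /= fgy.
  by rewrite (nbhs_singleton fg).
have dE := diff_unique cf Eg.
by apply/diff_locallyP; rewrite dE.
Qed.

Lemma deriveDdir (W : normedModType R) (f : V -> W) z v w :
  differentiable f z -> 'D_(v + w) f z = 'D_v f z + 'D_w f z.
Proof. by move=> df; rewrite !deriveE // linearD. Qed.

Lemma lsubmx_derive m n1 n2 (F : V -> 'M[R]_(m, n1 + n2)) z v :
  differentiable F z -> lsubmx ('D_v F z) = 'D_v (fun y => lsubmx (F y)) z.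
Proof.
move=> dF; have dl := differentiable_comp dF (differentiable_lsubmx (F z)).
rewrite !derive_mx; [|exact: diff_derivable..].
by apply/matrixP => i j; rewrite !mxE; congr ('D_v _ z); apply/funext => y; rewrite mxE.
Qed.

End MatrixCalculus.

(** * Coordinate expressions *)

Section InChart.
Variables (R : realType) (m : nat) (T : Type) (A : charts R m T).
Implicit Types (a : chart_index A).

Lemma in_chart_map (W W' : zmodType) (f : W -> W') a (F : T -> W) z :
  f 0 = 0 -> in_chart a (f \o F) z = f (in_chart a F z).
Proof. by move=> f0; rewrite /in_chart; case: pselect. Qed.

(** The condition at 0 accounts for the points outside of the image of the chart,
    where coordinate expressions take the value 0. *)
Lemma in_chart_map2 (W1 W2 W : zmodType) (f : W1 -> W2 -> W) a F G z :
  f 0 0 = 0 ->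
  in_chart a (fun t => f (F t) (G t)) z = f (in_chart a F z) (in_chart a G z).
Proof. by move=> f0; rewrite /in_chart; case: pselect. Qed.

Lemma eq_in_chart (W : zmodType) a (F G : T -> W) :
  (forall t, chart_dom a t -> F t = G t) -> in_chart a F = in_chart a G.
Proof.
move=> FG; apply/funext => z; rewrite /in_chart; case: pselect => // e.
by case: (cid e) => t [at_ _] /=; exact: FG.
Qed.

Lemma in_chart0 (W : zmodType) a : in_chart a (fun=> 0 : W) = cst 0.
Proof. by apply/funext => z; rewrite /in_chart; case: pselect. Qed.

(** Equality on the domain of the chart is enough, without any openness: the
    coordinate expressions are then equal everywhere, being 0 elsewhere. *)
Lemma eq_bracket (rho X Y : components A) a t :
  (forall s, chart_dom a s -> X a s = Y a s) -> chart_dom a t ->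
  bracket rho X a t = bracket rho Y a t.
Proof. by move=> XY at_; rewrite /bracket (eq_in_chart XY) XY. Qed.

Lemma bracket0 (rho : components A) a t : bracket rho (fun _ _ => 0) a t = 0.
Proof. by rewrite /bracket in_chart0 derive_cst derive0 subr0. Qed.

End InChart.

(** * Charts of the slit cotangent bundle *)

Section SlitCharts.
Variables (R : realType) (n : nat) (M : manifold R n).
Implicit Types (a : chart_index (slit_charts M)) (u : slit M).

Lemma slit_in_chartE (W : zmodType) a (F : slit M -> W) u :
  chart_dom a u -> in_chart a F (chart_coord a u) = F u.
Proof.
move=> au; rewrite /in_chart; case: pselect => [e|]; last by case; exists u.
case: (cid e) => v [av vu] /=; congr F.
exact: slit_inj av au vu.
Qed.

(** By the transformation rule, a covector that vanishes in one chart vanishes in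
    all of them. *)
Lemma covec_neq0 a u : chart_dom a u -> covec (sval u) a != 0.
Proof.
move=> au; apply/eqP => p0; apply: (svalP u) => b.
have [bu|bu] := pselect (chart_dom b (foot (sval u))).
  by rewrite (covec_change bu au) p0 mul0mx.
exact: covec_outside.
Qed.

(** Since the induced coordinates take all the values (x, p) with p nonzero, the
    image of a chart is visibly open. *)
Lemma slit_chart_imageE a :
  chart_image a =
  lsubmx @^-1` chart_image (a : chart_index (atlas M))
  `&` rsubmx @^-1` (~` [set 0]) :> set 'rV[R]_(n + n).
Proof.
apply/seteqP; split => [_ [u au <-]|z] /=.
  rewrite row_mxKl row_mxKr; split; first by exists (foot (sval u)).
  exact/eqP/covec_neq0.
move=> [[x ax xz] pz].
have [u [ux up]] := covector_ex (rsubmx z) ax.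
have nu : ~ zero_covector u by move=> u0; apply: pz; rewrite -up u0.
exists (exist _ u nu) => /=; first by rewrite ux.
by rewrite ux xz up hsubmxK.
Qed.

Lemma open_slit_chart_image a : open (chart_image a : set 'rV[R]_(n + n)).
Proof.
rewrite slit_chart_imageE; apply: openI; (apply: open_comp; first move=> z _).
- exact: continuous_lsubmx.
- apply: (atlas_open_map (manifold_atlas M)) => //.
  exact: (atlas_open (manifold_atlas M)).
- exact: continuous_rsubmx.
- apply: closed_openC; apply: accessible_closed_set1.
  apply: hausdorff_accessible; exact: norm_hausdorff.
Qed.

Lemma smooth_differentiable a (V : normedModType R) (f : 'rV[R]_(n + n) -> V) u :
  smooth_on (chart_image a) f -> chart_dom a u ->
  differentiable f (chart_coord a u).
Proof. by move=> /(_ 1%N)[df _] au; apply: df; exists u. Qed.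

(** Differentiability of rho, and not only of X and Y, is needed: the second term
    of the bracket is additive in its direction because it is the value of a
    differential. *)
Lemma bracketD (rho X Y : components (slit_charts M)) a u :
  chart_dom a u ->
  differentiable (in_chart a (rho a)) (chart_coord a u) ->
  differentiable (in_chart a (X a)) (chart_coord a u) ->
  differentiable (in_chart a (Y a)) (chart_coord a u) ->
  bracket rho (add_field X Y) a u = bracket rho X a u + bracket rho Y a u.
Proof.
move=> au drho dX dY; rewrite /bracket.
have -> : in_chart a (add_field X Y a) = in_chart a (X a) + in_chart a (Y a).
  by apply/funext => z; rewrite /add_field (in_chart_map2 (f := +%R)) ?addr0.
rewrite deriveD; [|exact: diff_derivable..].
by rewrite deriveDdir // opprD addrACA.
Qed.

End SlitCharts.

(** * The Hamiltonian vector field and the adapted tangent structure *)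

Section Hamilton.
Variables (R : realType) (n : nat) (M : manifold R n).
Variables (H : cotangent M -> R) (hamH : hamiltonian H).
Implicit Types (a : chart_index (slit_charts M)) (u : slit M).
Implicit Types (X V : components (slit_charts M)).

(** This agrees with the coordinate expression of the Hamiltonian vector field on
    the image of the chart only; the latter is 0 elsewhere. *)
Definition ham_field_coord a (z : 'rV[R]_(n + n)) : 'rV[R]_(n + n) :=
  row_mx (\row_i d_p i (ham_in_chart H a) z)
         (\row_i - d_x i (ham_in_chart H a) z).

Lemma ham_field_in_chart a u : chart_dom a u ->
  {near chart_coord a u, ham_field_coord a =1 in_chart a (ham_field H a)}.
Proof.
move=> au.
have : nbhs (chart_coord a u) (chart_image a).
  by apply: open_nbhs_nbhs; split; [exact: open_slit_chart_image | exists u].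
by apply: filterS => _ [v av <-]; rewrite slit_in_chartE.
Qed.

Lemma differentiable_ham_field_coord a u : chart_dom a u ->
  differentiable (ham_field_coord a) (chart_coord a u).
Proof.
move=> au.
have dD v : differentiable (fun z => 'D_v (ham_in_chart H a) z) (chart_coord a u).
  have [_ /(_ v)[+ _]] := ham_smooth hamH a 2%N.
  by apply; exists u.
apply: differentiable_mx => i j; rewrite ord1 /ham_field_coord.
rewrite -(splitK j); case: (fintype.split j) => k /=.
  rewrite (_ : (fun _ => _) = d_p k (ham_in_chart H a)); first exact: dD.
  by apply/funext => z; rewrite row_mxEl mxE.
rewrite (_ : (fun _ => _) = - (d_x k (ham_in_chart H a))).
  by apply: differentiableN; exact: dD.
by apply/funext => z; rewrite row_mxEr mxE.
Qed.

Lemma differentiable_ham_field a u : chart_dom a u ->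
  differentiable (in_chart a (ham_field H a)) (chart_coord a u).
Proof.
move=> au; apply: near_eq_differentiable (ham_field_in_chart au) _.
exact: differentiable_ham_field_coord.
Qed.

Lemma ham_hessian_unit a u : chart_dom a u -> ham_hessian H a u \in unitmx.
Proof. by move=> au; rewrite -row_free_unit /row_free ham_rank. Qed.

(** The d/dx components of the Hamiltonian vector field are the dH/dp_j, whose
    derivatives along the fibre are by definition the entries of the Hessian. *)
Lemma lsubmx_derive_ham_field a u (p : 'rV[R]_n) : chart_dom a u ->
  lsubmx ('D_(row_mx 0 p) (in_chart a (ham_field H a)) (chart_coord a u)) =
  p *m ham_hessian H a u.
Proof.
move=> au; have dr := differentiable_ham_field_coord au.
rewrite -(near_eq_derive _ (ham_field_in_chart au)).
have -> : row_mx 0 p = \sum_i p 0 i *: delta_mx 0 (rshift n i) :> 'rV[R]_(n + n).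
  rewrite [LHS]matrix_sum_delta big_ord1 big_split_ord /= big1 ?add0r.
    by apply: eq_bigr => i _; rewrite row_mxEr.
  by move=> i _; rewrite row_mxEl mxE scale0r.
rewrite deriveE // linear_sum /= linear_sum /= mulmx_sum_row.
apply: eq_bigr => i _; rewrite !linearZ /=; congr (_ *: _).
rewrite -deriveE // lsubmx_derive //.
have dl := differentiable_comp dr
  (differentiable_lsubmx (ham_field_coord a (chart_coord a u))).
rewrite derive_mx; last exact: diff_derivable.
apply/rowP => j; rewrite !mxE /d_p; congr ('D_ _ _ _).
by apply/funext => z; rewrite row_mxKl mxE.
Qed.

(** The d/dx components of V vanish in the whole chart, so that differentiating
    them along rho gives 0 and only the derivative of rho along V is left. *)
Lemma lsubmx_bracket_vertical V a u : chart_dom a u ->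
  (forall t, chart_dom a t -> lsubmx (V a t) = 0) ->
  differentiable (in_chart a (V a)) (chart_coord a u) ->
  lsubmx (bracket (ham_field H) V a u) = - (rsubmx (V a u) *m ham_hessian H a u).
Proof.
move=> au V0 dV; rewrite /bracket linearB /= lsubmx_derive //.
rewrite (_ : (fun _ => _) = cst 0).
  rewrite derive_cst sub0r -[X in 'D_X _ _]hsubmxK V0 //.
  by rewrite lsubmx_derive_ham_field.
apply/funext => z; rewrite -(in_chart_map (f := lsubmx)) ?linear0 //.
by rewrite (eq_in_chart (G := fun=> 0)) ?in_chart0.
Qed.

Lemma mul_adapted_tangent a u (w : 'rV[R]_(n + n)) :
  w *m adapted_tangent H a u = row_mx 0 (lsubmx w *m invmx (ham_hessian H a u)).
Proof.
by rewrite -{1}[w]hsubmxK mul_row_block !mulmx0 !addr0.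
Qed.

(** Invertibility of (g_{ij}) makes the kernel of the adapted tangent structure
    equal to the vertical distribution. *)
Lemma newtonoidP X : newtonoid H X <->
  forall a u, chart_dom a u -> lsubmx (bracket (ham_field H) X a u) = 0.
Proof.
split=> nX a u au; last first.
  by rewrite /apply_endo mul_adapted_tangent nX // mul0mx row_mx0.
have /(congr1 rsubmx) := nX a u au.
rewrite /apply_endo mul_adapted_tangent row_mxKr linear0.
move=> /(congr1 (mulmx^~ (ham_hessian H a u))).
by rewrite mulmxKV ?ham_hessian_unit // mul0mx.
Qed.

End Hamilton.

(** * The projectors of a nonlinear connection *)

Section Connection.
Variables (R : realType) (n : nat) (M : manifold R n).
Variables (N : endo_components (slit_charts M)) (connN : nonlinear_connection N).
Implicit Types (a : chart_index (slit_charts M)) (u : slit M).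
Implicit Types (X : components (slit_charts M)).

Lemma hvproj_add a u : hproj N a u + vproj N a u = 1%:M.
Proof.
rewrite /hproj /vproj -scalerDr addrACA subrr addr0 -mulr2n.
by rewrite -scalerMnr scalerMnl -mulr_natr mulVf ?pnatr_eq0 // scale1r.
Qed.

Lemma hvproj_mul a u : chart_dom a u -> hproj N a u *m vproj N a u = 0.
Proof.
move=> au; rewrite /hproj /vproj -scalemxAl -scalemxAr mulmxDl mul1mx mulmxBr.
by rewrite mulmx1 (connection_sqr connN) // addrC subrKA subrr !scaler0.
Qed.

(** (Id - N)(Id + N) = 0 because N is an involution, so the image of v lies in
    ker (Id + N). *)
Lemma vproj_vertical a u (w : 'rV[R]_(n + n)) :
  chart_dom a u -> lsubmx (w *m vproj N a u) = 0.
Proof.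
move=> au; apply/(connection_ker connN au).
rewrite /vproj -mulmxA -scalemxAl mulmxDr mulmx1 mulmxBl mul1mx.
by rewrite (connection_sqr connN) // subrKA subrr scaler0 mulmx0.
Qed.

Lemma hproj_of_vertical a u (w : 'rV[R]_(n + n)) :
  chart_dom a u -> lsubmx w = 0 -> w *m hproj N a u = 0.
Proof.
move=> au /(connection_ker connN au) w0.
by rewrite /hproj -scalemxAr w0 scaler0.
Qed.

Lemma vproj_of_vertical a u (w : 'rV[R]_(n + n)) :
  chart_dom a u -> lsubmx w = 0 -> w *m vproj N a u = w.
Proof.
move=> au w0; rewrite -[RHS]mulmx1 -(hvproj_add a u) mulmxDr.
by rewrite hproj_of_vertical // add0r.
Qed.

Lemma lsubmx_hproj a u (w : 'rV[R]_(n + n)) :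
  chart_dom a u -> lsubmx (w *m hproj N a u) = lsubmx w.
Proof.
move=> au; rewrite -[in RHS](mulmx1 w) -(hvproj_add a u) mulmxDr linearD /=.
by rewrite vproj_vertical // addr0.
Qed.

Lemma differentiable_endo X a u : vector_field X -> chart_dom a u ->
  differentiable (in_chart a (apply_endo N X a)) (chart_coord a u).
Proof.
move=> [_ sX] au; have [_ sN] := connection_tensor connN.
have -> : in_chart a (apply_endo N X a) =
    (fun z => in_chart a (X a) z *m in_chart a (N a) z).
  by apply/funext => z; rewrite -(in_chart_map2 (f := mulmx)) // mul0mx.
by apply: differentiable_mulmx; exact: smooth_differentiable.
Qed.

Lemma differentiable_hproj X a u : vector_field X -> chart_dom a u ->
  differentiable (in_chart a (apply_endo (hproj N) X a)) (chart_coord a u).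
Proof.
move=> vX au; have dNX := differentiable_endo vX au; have [_ sX] := vX.
have -> : in_chart a (apply_endo (hproj N) X a) =
    2^-1 *: (in_chart a (X a) + in_chart a (apply_endo N X a)).
  apply/funext => z.
  rewrite -[RHS](in_chart_map2 (f := fun x y : 'rV[R]_(n + n) => 2^-1 *: (x + y)));
    last by rewrite addr0 scaler0.
  congr (in_chart _ _ _); apply/funext => t.
  by rewrite /apply_endo /hproj -scalemxAr mulmxDr mulmx1.
apply: differentiableZ; apply: differentiableD => //.
exact: smooth_differentiable.
Qed.

Lemma differentiable_vproj X a u : vector_field X -> chart_dom a u ->
  differentiable (in_chart a (apply_endo (vproj N) X a)) (chart_coord a u).
Proof.
move=> vX au; have dhX := differentiable_hproj vX au; have [_ sX] := vX.
have -> : in_chart a (apply_endo (vproj N) X a) =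
    in_chart a (X a) - in_chart a (apply_endo (hproj N) X a).
  apply/funext => z.
  rewrite -[RHS](in_chart_map2 (f := fun x y : 'rV[R]_(n + n) => x - y));
    last by rewrite subr0.
  congr (in_chart _ _ _); apply/funext => t.
  have vE : vproj N a t = 1%:M - hproj N a t by rewrite -(hvproj_add a t) addrC addKr.
  by rewrite /apply_endo vE mulmxBr mulmx1.
by apply: differentiableB => //; exact: smooth_differentiable.
Qed.

End Connection.

(** * Newtonoid vector fields *)

Section Newtonoid.
Variables (R : realType) (n : nat) (M : manifold R n).
Variables (H : cotangent M -> R) (hamH : hamiltonian H).
Variables (N : endo_components (slit_charts M)) (connN : nonlinear_connection N).
Variables (X : components (slit_charts M)) (vfX : vector_field X).
Implicit Types (a : chart_index (slit_charts M)) (u : slit M).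

Local Notation rho := (ham_field H).
Local Notation hX := (apply_endo (hproj N) X).
Local Notation vX := (apply_endo (vproj N) X).

Lemma bracket_hv a u : chart_dom a u ->
  bracket rho X a u = bracket rho hX a u + bracket rho vX a u.
Proof.
move=> au.
rewrite -(bracketD au (differentiable_ham_field hamH au)
  (differentiable_hproj connN vfX au) (differentiable_vproj connN vfX au)).
congr (bracket _ _ a u); apply/funext => b; apply/funext => t.
by rewrite /add_field /apply_endo -mulmxDr hvproj_add mulmx1.
Qed.

(** J only sees the d/dx components, and those of nabla X are the ones of
    [rho, hX]; as [rho, X] is vertical they are opposite to those of [rho, vX],
    which the Hessian computes from vX. *)
Lemma adapted_tangent_dyn_cov_deriv a u : newtonoid H X -> chart_dom a u ->
  apply_endo (adapted_tangent H) (dyn_cov_deriv H N X) a u = vX a u.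
Proof.
move=> /(newtonoidP hamH) nX au.
have vert t : chart_dom a t -> lsubmx (vX a t) = 0.
  by move=> at_; exact: vproj_vertical.
have E : lsubmx (bracket rho hX a u) = rsubmx (vX a u) *m ham_hessian H a u.
  have := nX a u au; rewrite (bracket_hv au) linearD /=.
  have dv := differentiable_vproj connN vfX au.
  rewrite [X in _ + X](lsubmx_bracket_vertical hamH au vert dv).
  by move/eqP; rewrite subr_eq0 => /eqP.
rewrite {1}/apply_endo mul_adapted_tangent /dyn_cov_deriv /add_field linearD /=.
rewrite {1 3}/apply_endo (lsubmx_hproj connN _ au) (vproj_vertical connN _ au) addr0 E.
rewrite (mulmxK (ham_hessian_unit hamH au)) -[RHS]hsubmxK.
by rewrite (vert u au).
Qed.

(** The field J (nabla X) equals vX on the whole domain of the chart, which is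
    what allows the replacement under the brackets; its h part is then 0. *)
Lemma dyn_cov_deriv_adapted_tangent a u : newtonoid H X -> chart_dom a u ->
  dyn_cov_deriv H N (apply_endo (adapted_tangent H) (dyn_cov_deriv H N X)) a u =
  bracket rho vX a u *m vproj N a u.
Proof.
move=> nX au; set V := apply_endo (adapted_tangent H) _.
have vert t : chart_dom a t -> lsubmx (V a t) = 0.
  move=> at_; rewrite /V adapted_tangent_dyn_cov_deriv //.
  exact: (vproj_vertical connN _ at_).
have hV t : chart_dom a t -> apply_endo (hproj N) V a t = 0.
  by move=> at_; exact: (hproj_of_vertical connN at_ (vert t at_)).
have vV t : chart_dom a t -> apply_endo (vproj N) V a t = vX a t.
  move=> at_; rewrite -(adapted_tangent_dyn_cov_deriv nX at_).
  exact: (vproj_of_vertical connN at_ (vert t at_)).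
have -> : dyn_cov_deriv H N V a u =
    bracket rho (apply_endo (hproj N) V) a u *m hproj N a u +
    bracket rho (apply_endo (vproj N) V) a u *m vproj N a u by [].
have -> := @eq_bracket _ _ _ _ rho _ (fun _ _ => 0) a u hV au.
have -> := eq_bracket rho vV au.
by rewrite bracket0 mul0mx add0r.
Qed.

Lemma newtonoid_equation a u : newtonoid H X -> chart_dom a u ->
  add_field (dyn_cov_deriv H N
               (apply_endo (adapted_tangent H) (dyn_cov_deriv H N X)))
            (jacobi_endo H N X) a u =
  bracket rho X a u.
Proof.
move=> nX au; rewrite /add_field dyn_cov_deriv_adapted_tangent //.
have -> : jacobi_endo H N X a u =
    (bracket rho hX a u - bracket rho X a u *m hproj N a u) *m vproj N a u by [].
rewrite -mulmxDl addrA [X in X - _]addrC -(bracket_hv au).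
rewrite [LHS]mulmxBl -mulmxA (hvproj_mul connN au) mulmx0 subr0.
apply: (vproj_of_vertical connN au).
by move/(newtonoidP hamH) : nX; apply.
Qed.

End Newtonoid.

Theorem proposition3 (R : realType) (n : nat) (M : manifold R n)
    (H : cotangent M -> R) (hamH : hamiltonian H)
    (N : endo_components (slit_charts M)) (connN : nonlinear_connection N)
    (X : components (slit_charts M)) (vfX : vector_field X) :
  infinitesimal_symmetry H X <->
  (newtonoid H X /\
   vanishes (add_field (dyn_cov_deriv H N
                     (apply_endo (adapted_tangent H) (dyn_cov_deriv H N X)))
                  (jacobi_endo H N X))).
Proof.
split=> [sX|[nX eX] a u au].
  have nX : newtonoid H X by move=> a u au; rewrite /apply_endo sX // mul0mx.
  by split=> // a u au; rewrite newtonoid_equation // sX.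
by rewrite -(newtonoid_equation hamH connN vfX nX au) eX.
Qed.
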